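(* If $X$ is a Hausdorff space, then $|X|\leq 2^{aL'(X)\,t_c(X)\,\psi_c(X)}$.
   Context: An open ultrafilter on a Hausdorff space $X$ is a maximal filter in the family of open subsets of $X$ (its members are nonempty open sets); it converges to $x\in X$ if it contains every open set containing $x$. $EX$ is the set of all convergent open ultrafilters on $X$. A section is a function $b:X\to EX$ such that $b(x)$ converges to $x$ for every $x\in X$. For a section $b$ and an open set $U$ let $\widehat{U}_b=\{x\in X: U\in b(x)\}$, and for $A\subseteq X$ let $c_b(A)=\{x\in X:\widehat{U}_b\cap A\neq\varnothing\text{ for every open }U\ni x\}$. $A$ is $c_b$-closed if $c_b(A)=A$. For $A\subseteq X$, $aL(A,X)$ is the least infinite cardinal $\kappa$ such that every cover $\mathcal V$ of $A$ by open sets of $X$ has a subfamily $\mathcal W$ with $|\mathcal W|\leq\kappa$ and $A\subseteq\bigcup_{W\in\mathcal W}cl\,W$. Put $aL^b(X)=\sup\{aL(C,X): C\text{ is }c_b\text{-closed}\}+\aleph_0$ and $aL'(X)=\min\{aL^b(X): b\text{ a section}\}$. Fix any section $b'$ with $aL^{b'}(X)=aL'(X)$ and write $c=c_{b'}$. $t_c(X)$ is the least infinite cardinal $\kappa$ such that whenever $x\in c(A)$, $A\subseteq X$, there is $B\subseteq A$ with $|B|\leq\kappa$ and $x\in c(B)$. $\psi_c(X)$ is the least infinite cardinal $\kappa$ such that each $x\in X$ has a family $\mathcal V$ of at most $\kappa$ open sets containing $x$ with $\{x\}=\bigcap_{V\in\mathcal V}cl\,V$. *)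

(* Defs.v *)
From HB Require Import structures.
From mathcomp Require Import all_boot.
From mathcomp Require Import boolp classical_sets functions cardinality.
From mathcomp Require Import filter topology.

Set Implicit Arguments.
Unset Strict Implicit.
Unset Printing Implicit Defensive.

Local Open Scope classical_set_scope.
Local Open Scope card_scope.

(* Cardinals are represented by types, compared through the library's
   equipotence [#=] and injectability [#<=] of their full sets.  Consequently
   cardinal-valued operations are only determined up to equipotence. *)

Definition is_least_cardinal (P : Type -> Prop) (K : Type) : Prop :=
  P K /\ forall K' : Type, P K' -> [set: K] #<= [set: K'].

(* The value [nat] is only taken when no type satisfies [P]: see
   [least_cardinalP] below. *)
Definition least_cardinal (P : Type -> Prop) : Type :=
  if pselect (exists K, is_least_cardinal P K) is left h
  then projT1 (cid h) else nat.

Lemma inj_setT_card_le (A B : Type) (f : A -> B) :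
  injective f -> [set: A] #<= [set: B].
Proof.
move=> fI; have fE : f @` [set: A] #= [set: A].
  by apply: inj_card_eq => x y _ _; apply: fI.
by move: fE; rewrite card_eq_sym card_eq_le => /andP[h _];
  apply: card_le_trans h _; apply: subset_card_le.
Qed.

Lemma card_min_family (I : Type) (F : I -> Type) (i0 : I) :
  exists i, forall j, [set: F i] #<= [set: F j].
Proof.
pose P : set (set (forall i, F i)) :=
  [set S | forall f g, S f -> S g -> forall i, f i = g i -> f = g].
have [S [PS maxS]] : exists A, P A /\ forall B, A `<` B -> ~ P B.
  apply: Zorn_bigcup => G GP Gtot f g [A GA Af] [B GB Bg] i.
  by have [AB|BA] := Gtot _ _ GA GB;
    [apply: (GP _ GB) => //; apply: AB | apply: (GP _ GA) => //; apply: BA].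
have [i iS] : exists i, forall x : F i, exists f, S f /\ f i = x.
  apply: contrapT => /forallNP noi.
  have /(_ _)/cid-/all_sig[g gS] i : exists x : F i, ~ exists f, S f /\ f i = x.
    by apply/existsNP.
  have Sg : ~ S g by move=> Sg; apply: (gS i0); exists g.
  apply: (maxS (S `|` [set g])).
    by split=> [f Sf|/(_ g (or_intror erefl))]; first left.
  move=> f h [Sf|->] [Sh|->] i fh //; first exact: (PS f h Sf Sh i).
    by case: (gS i); exists f.
  by case: (gS i); exists h.
have /(_ _)/cid-/all_sig[f fS] := iS.
exists i => j; apply: (@inj_setT_card_le _ _ (fun x => f x j)) => x y fxy.
have [Sx <-] := fS x; have [Sy <-] := fS y.
by rewrite (PS _ _ Sx Sy j fxy).
Qed.

Lemma card_le_totalT (A B : Type) :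
  [set: A] #<= [set: B] \/ [set: B] #<= [set: A].
Proof.
have [[] h] := card_min_family (fun b : bool => if b then A else B) true.
  by left; apply: (h false).
by right; apply: (h true).
Qed.

Lemma least_cardinalP (P : Type -> Prop) :
  (exists K, P K) -> is_least_cardinal P (least_cardinal P).
Proof.
move=> [K0 PK0]; rewrite /least_cardinal; case: pselect => [h|[]].
  exact: projT2 (cid h).
pose I := {A : set K0 | exists K, P K /\ [set: K] #= A}.
pose F (i : I) := projT1 (cid (proj2_sig i)).
have FP i : P (F i) by have [] := projT2 (cid (proj2_sig i)).
have FE i : [set: F i] #= proj1_sig i by have [] := projT2 (cid (proj2_sig i)).
have IT : exists K, P K /\ [set: K] #= [set: K0] by exists K0.
pose i0 : I := exist _ [set: K0] IT.
have [i imin] := card_min_family F i0.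
exists (F i); split=> // K' PK'.
have [K0K'|] := card_le_totalT K0 K'.
  apply: card_le_trans (imin i0) (card_le_trans _ K0K').
  by move: (FE i0); rewrite card_eq_le => /andP[].
move=> /card_leP[f]; pose g x := set_val (f (to_setT x)).
pose A := g @` [set: K'].
have K'A : [set: K'] #= A.
  rewrite card_eq_sym; apply: inj_card_eq => x y _ _ /val_inj fxy.
  have /(congr1 set_val) // : to_setT x = to_setT y.
  by apply: (@inj _ _ _ f) fxy; rewrite inE.
have IA : exists K, P K /\ [set: K] #= A by exists K'.
apply: card_le_trans (imin (exist _ A IA)) _.
have /= := FE (exist _ A IA); rewrite card_eq_le => /andP[h _].
by apply: card_le_trans h _; move: K'A; rewrite card_eq_le => /andP[].
Qed.

(* The supremum of the cardinals satisfying [S]. *)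
Definition sup_cardinal (S : Type -> Prop) : Type :=
  least_cardinal (fun K => forall K' : Type, S K' -> [set: K'] #<= [set: K]).

Definition least_infinite_cardinal (P : Type -> Prop) : Type :=
  least_cardinal (fun K => infinite_set [set: K] /\ P K).

Section Invariants.
Variable X : topologicalType.

(* Filters in the family of open sets, hence upward closed only with respect to
   open supersets: they are not filters on [X] in the sense of the library. *)
Definition open_filter (F : set (set X)) : Prop :=
  [/\ F `<=` open, F setT, ~ F set0,
      forall U V, F U -> F V -> F (U `&` V)
    & forall U V, open V -> U `<=` V -> F U -> F V].

Definition open_ultrafilter (F : set (set X)) : Prop :=
  open_filter F /\ forall G, open_filter G -> F `<=` G -> G = F.

Definition open_converges (F : set (set X)) (x : X) : Prop :=
  forall U, open U -> U x -> F U.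

Definition EX : Type :=
  {F : set (set X) | open_ultrafilter F /\ exists x, open_converges F x}.

Definition is_section (b : X -> EX) : Prop :=
  forall x, open_converges (proj1_sig (b x)) x.

Definition hat (b : X -> EX) (U : set X) : set X :=
  [set x | proj1_sig (b x) U].

Definition c_ (b : X -> EX) (A : set X) : set X :=
  [set x | forall U, open U -> U x -> hat b U `&` A !=set0].

Definition c_closed (b : X -> EX) (A : set X) : Prop := c_ b A = A.

Definition aL (A : set X) : Type := least_infinite_cardinal (fun K =>
  forall V : set (set X),
    V `<=` open -> A `<=` \bigcup_(U in V) U ->
  exists W : set (set X),
    [/\ W `<=` V, W #<= [set: K] & A `<=` \bigcup_(U in W) closure U]).

Definition aLb (b : X -> EX) : Type :=
  (sup_cardinal (fun K => exists2 C, c_closed b C & K = aL C) + nat)%type.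

Definition aL' : Type :=
  least_cardinal (fun K => exists2 b, is_section b & K = aLb b).

Definition t_c (b : X -> EX) : Type := least_infinite_cardinal (fun K =>
  forall (A : set X) (x : X), c_ b A x ->
  exists B : set X, [/\ B `<=` A, B #<= [set: K] & c_ b B x]).

Definition psi_c : Type := least_infinite_cardinal (fun K =>
  forall x : X, exists V : set (set X),
    [/\ V #<= [set: K], forall U, V U -> open U /\ U x
      & [set x] = \bigcap_(U in V) closure U]).

End Invariants.

(* Main.v *)
(* Let [K] have cardinality [aL' X * t_c b' * psi_c X].  A point [x] of [c A]
   lies in [c B] for some [B] of size at most [K] included in [A], and it is the
   only point in all the sets [c (hat V `&` B)], where [V] ranges over a family
   witnessing [psi_c] at [x]: hence [x] is the value of a [K]-ary operation on
   [A], with one of [2 ^ K] labels.  Likewise, choosing a point outside the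
   union of [K] closures of witnessing neighbourhoods of points of [A] is such
   an operation.  A set [H] of size at most [2 ^ K] closed under both operations
   is [c]-closed.  If [q] were outside [H], covering [H] by neighbourhoods whose
   closures miss [q] and using [aL H <= K], the second operation would give a
   point of [H] outside closures that cover [H].
   The [2 ^ K] bound on [H] comes from well-founded [K]-branching trees, in place
   of the usual recursion of length [K ^+]. *)

Require Import Defs.
From mathcomp Require Import all_boot.
From mathcomp Require Import boolp classical_sets functions cardinality.
From mathcomp Require Import filter topology.

Local Open Scope classical_set_scope.
Local Open Scope card_scope.

(** * Injections and enumerations from cardinal inequalities *)

Lemma card_le_setT_inj {A B : Type} :
  [set: A] #<= [set: B] -> exists f : A -> B, injective f.
Proof.
move=> /card_leP[f]; exists (fun x => set_val (f (to_setT x))) => x y fxy.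
have /(congr1 set_val) // : to_setT x = to_setT y.
by apply: (@inj _ _ _ f); rewrite ?inE //; apply: val_inj fxy.
Qed.

Lemma card_le_inj_in {A B : Type} (P : set A) (Q : set B) (b0 : B) :
  P #<= Q -> exists f : A -> B,
    (forall x, P x -> Q (f x)) /\
    (forall x y, P x -> P y -> f x = f y -> x = y).
Proof.
move=> /card_leP[g].
pose f x := if pselect (P x) is left Px
  then set_val (g (SigSub (mem_set Px))) else b0.
exists f; split=> [x Px|x y Px Py]; rewrite /f; case: pselect => // Px'.
  exact: set_valP.
case: pselect => // Py' fxy.
have gxy : g (SigSub (mem_set Px')) = g (SigSub (mem_set Py')).
  exact: val_inj fxy.
by have /(congr1 set_val) := @inj _ _ _ g _ _ (mem_set I) (mem_set I) gxy.
Qed.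

Lemma inj_in_card_le {A B : Type} (P : set A) (Q : set B) (f : A -> B) :
  (forall x, P x -> Q (f x)) ->
  (forall x y, P x -> P y -> f x = f y -> x = y) -> P #<= Q.
Proof.
move=> PQ fI; have : f @` P #= P.
  by apply: inj_card_eq => x y /set_mem Px /set_mem Py; apply: fI.
rewrite card_eq_sym card_eq_le => /andP[h _]; apply: card_le_trans h _.
by apply: subset_card_le => _ [x Px <-]; apply: PQ.
Qed.

Lemma injective_left_inverse {A B : Type} (a0 : A) (f : A -> B) :
  injective f -> exists g, cancel f g.
Proof.
move=> fI.
exists (fun y => if pselect (exists x, f x = y) is left h
  then projT1 (cid h) else a0) => x.
case: pselect => [h|[]]; last by exists x.
by apply: fI; case: (cid h).
Qed.

Lemma card_le_setT_enum {A K : Type} (B : set A) (a0 : A) :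
  B a0 -> B #<= [set: K] -> exists f : K -> A, f @` [set: K] = B.
Proof.
move=> Ba0 BK; have [k0 _] : [set: K] !=set0.
  apply/set0P/eqP => K0; move: BK; rewrite K0 card_le0 => /eqP B0.
  by move: Ba0; rewrite B0.
have [g [_ gI]] := card_le_inj_in B [set: K] k0 BK.
pose f k := if pselect (exists2 x, B x & g x = k) is left h
  then projT1 (cid2 h) else a0.
have fB k : B (f k) by rewrite /f; case: pselect => // h; case: (cid2 h).
exists f; apply/seteqP; split=> [_ [k _ <-] //|x Bx].
exists (g x) => //; rewrite /f; case: pselect => [h|[]]; last by exists x.
by case: (cid2 h) => y By gyx /=; apply: gI.
Qed.

(** * Squares of infinite cardinals *)

Definition pairing_on {K : Type} (A : set K) (f : K -> K -> K) : Prop :=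
  (forall x y, A x -> A y -> A (f x y)) /\
  (forall x y x' y', A x -> A y -> A x' -> A y' ->
    f x y = f x' y' -> x = x' /\ y = y').

(** Zorn's lemma for pairings whose domain contains a countable set [range h]. Values off the domain
    are ignored, so extension is only a preorder and maximality is about domains. *)
Lemma pairing_on_maximal {K : Type} : infinite_set [set: K] ->
  exists (A : set K) f, [/\ pairing_on A f, infinite_set A &
    forall B g, pairing_on B g -> A `<=` B ->
      (forall x y, A x -> A y -> g x y = f x y) -> B = A].
Proof.
move=> /infiniteP /card_le_setT_inj[h hI].
have [h' hK] := injective_left_inverse 0 h hI.
pose R (s t : set K * (K -> K -> K)) := s.1 `<=` t.1 /\
  forall x y, s.1 x -> s.1 y -> t.2 x y = s.2 x y.
pose good p := pairing_on p.1 p.2 /\ range h `<=` p.1.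
(* The coding of pairs of naturals, transported along [h]. *)
have good0 : good (range h, fun x y => h (choice.pickle (h' x, h' y))).
  split=> //; split=> /= [x y _ _|_ _ _ _ [a _ <-] [b _ <-] [c _ <-] [d _ <-]].
    by exists (choice.pickle (h' x, h' y)).
  by rewrite !hK => /hI /(pcan_inj choice.pickleK) [-> ->].
pose T := {p | good p}.
pose RT (s t : T) := `[< R (sval s) (sval t) >].
have Rxx p : R p p by split.
have Rtr r s t : R r s -> R s t -> R r t.
  move=> [rs1 rs2] [st1 st2]; split=> [x /rs1/st1 //|x y rx ry].
  by rewrite st2 ?rs2 //; apply: rs1.
have [||C Ctot|[[A f] [fA hA]] max] := @ZL_preorder T (exist _ _ good0) RT.
- by move=> t; apply/asboolP.
- move=> r s t /asboolP rs /asboolP st; apply/asboolP; exact: Rtr rs st.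
- have [[s0 Cs0]|noC] := pselect (exists s, C s); last first.
    by exists (exist _ _ good0) => s Cs; case: noC; exists s.
  (* Upper bound of a nonempty chain: [A] is the union of the domains, [F] that of the graphs. *)
  pose A : set K := [set x | exists2 s : T, C s & (sval s).1 x].
  pose F x y z := exists s : T,
    [/\ C s, (sval s).1 x, (sval s).1 y & z = (sval s).2 x y].
  have Fex x y : A x -> A y -> exists s : T,
      [/\ C s, (sval s).1 x & (sval s).1 y].
    move=> [s Cs sx] [t Ct ty].
    have [/asboolP[st _]|/asboolP[ts _]] := Ctot _ _ Cs Ct.
      by exists t; split=> //; apply: st.
    by exists s; split=> //; apply: ts.
  have Fun x y z z' : F x y z -> F x y z' -> z = z'.
    move=> [s [Cs sx sy ->]] [t [Ct tx ty ->]].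
    have [/asboolP[_ st]|/asboolP[_ ts]] := Ctot _ _ Cs Ct.
      by rewrite st.
    by rewrite ts.
  pose f x y := if pselect (exists z, F x y z) is left e
    then projT1 (cid e) else h 0.
  have fE (s : T) x y : C s -> (sval s).1 x -> (sval s).1 y ->
      f x y = (sval s).2 x y.
    move=> Cs sx sy; rewrite /f; case: pselect => [e|[]]; last first.
      by exists ((sval s).2 x y), s.
    by case: (cid e) => z /= Fz; apply: Fun Fz _; exists s.
  have gA : good (A, f).
    split=> /=; last first.
      by move=> x hx; exists s0 => //; apply: (proj2 (proj2_sig s0)).
    split=> /= [x y Ax Ay|x y x' y' Ax Ay Ax' Ay'].
      have [s [Cs sx sy]] := Fex _ _ Ax Ay; exists s => //.
      by rewrite (fE s) //; apply: (proj1 (proj1 (proj2_sig s))).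
    have [s [Cs sx sy]] := Fex _ _ Ax Ay.
    have [t [Ct tx ty]] := Fex _ _ Ax' Ay'.
    have [/asboolP[st _]|/asboolP[ts _]] := Ctot _ _ Cs Ct.
      rewrite !(fE t) //; try exact: st.
      by apply: (proj2 (proj1 (proj2_sig t))) => //; apply: st.
    rewrite !(fE s) //; try exact: ts.
    by apply: (proj2 (proj1 (proj2_sig s))) => //; apply: ts.
  exists (exist _ _ gA) => s Cs; apply/asboolP; split=> [x sx|x y sx sy] /=.
    by exists s.
  exact: fE.
exists A, f; split=> //.
  apply: sub_infinite_set (hA) _; apply/infiniteP.
  by apply: (inj_in_card_le _ _ h) => [n _|m n _ _ /hI //]; exists n.
move=> B g gB AB gf.
have gd : good (B, g) by split=> // x hx; apply/AB/hA.
have /asboolP[BA _] := max (exist _ _ gd) (asboolT (conj AB gf)).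
exact/seteqP.
Qed.

(** It suffices to inject [K] into the domain [A] of a maximal pairing. This is possible if the
    complement of [A] injects into [A]; otherwise the complement contains a copy of [A], and the
    pairing extends to the union of both, against maximality. *)
Lemma infinite_card_square {K : Type} : infinite_set [set: K] ->
  [set: K * K] #<= [set: K].
Proof.
move=> Kinf.
have [A [f [[fA fI] /infiniteP Ainf max]]] := pairing_on_maximal Kinf.
have [k0 _] := infinite_setN0 Kinf.
have [h [hA hI]] := card_le_inj_in [set: nat] A k0 Ainf.
have {}hA n : A (h n) by apply: hA.
have {}hI m n : h m = h n -> m = n by apply: hI.
suff [j [jA jI]] : exists j : K -> K, (forall x, A (j x)) /\ injective j.
  apply: (inj_setT_card_le (f := fun p => f (j p.1) (j p.2))) => -[x y] [x' y'].
  by move=> /= /(fI _ _ _ _ (jA x) (jA y) (jA x') (jA y'))[/jI -> /jI ->].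
have [/card_le_setT_inj[i iI]|/card_le_setT_inj[i iI]] :=
    card_le_totalT (set_type A) (set_type (~` A)); last first.
  (* The tags [h 0] and [h 1] keep the images of [A] and of its complement apart. *)
  pose j x := match pselect (A x) with
    | left _ => f (h 0) x
    | right nAx =>
        f (h 1) (set_val (i (SigSub (mem_set (nAx : (~` A) x))))) end.
  exists j; split=> [x|x y]; rewrite /j; case: pselect => Ax.
  - exact: fA.
  - by apply: fA => //; apply: set_valP.
  - case: pselect => Ay.
      by move=> /(fI _ _ _ _ (hA 0) Ax (hA 0) Ay)[].
    by move=> /(fI _ _ _ _ (hA 0) Ax (hA 1) (set_valP _))[/hI].
  - case: pselect => Ay.
      by move=> /(fI _ _ _ _ (hA 1) (set_valP _) (hA 0) Ay)[/hI].
    move=> /(fI _ _ _ _ (hA 1) (set_valP _) (hA 1) (set_valP _))[_].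
    by move=> /val_inj/iI/(congr1 set_val).
pose e x := match pselect (A x) with
  | left Ax => set_val (i (SigSub (mem_set Ax))) | right _ => x end.
have eA x : A x -> ~ A (e x).
  move=> Ax; rewrite /e; case: pselect => // Ax' Aix.
  exact: (set_valP (i (SigSub (mem_set Ax'))) Aix).
have eI x y : A x -> A y -> e x = e y -> x = y.
  move=> Ax Ay; rewrite /e; case: pselect => // Ax'; case: pselect => // Ay'.
  by move=> /val_inj/iI/(congr1 set_val).
pose B := A `|` e @` A.
(* [d x] is the point of [A] that [x] comes from, directly or through [e]. *)
have /(_ _)/cid-/all_sig[d dP] x : exists a, B x ->
    A a /\ x = if `[< A x >] then a else e a.
  have [[Ax|[a Aa <-]]|nBx] := pselect (B x); last by exists k0.
    by exists x; rewrite asboolT.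
  by exists a; rewrite asboolF //; apply: eA.
(* The pairs outside [A * A] are sent to [e @` A], disjoint from [A]. *)
pose g x y := if `[< A x /\ A y >] then f x y
  else e (f (f (h `[< A x >]) (h `[< A y >])) (f (d x) (d y))).
have gA x y : B x -> B y ->
    A (f (f (h `[< A x >]) (h `[< A y >])) (f (d x) (d y))).
  by move=> /dP[dx _] /dP[dy _]; apply: (fA); apply: fA.
have BA : B = A.
  apply: (max B g); last by move=> x y Ax Ay; rewrite /g asboolT.
    2: by move=> x Ax; left.
  split.
  - move=> x y Bx By; rewrite /g; case: asboolP => [[Ax Ay]|nA].
      by left; apply: fA.
    right; exists (f (f (h `[< A x >]) (h `[< A y >])) (f (d x) (d y))) => //.
    exact: gA.
  - move=> x y x' y' Bx By Bx' By'; rewrite /g.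
    case: asboolP => [[Ax Ay]|nA];
      case: (asboolP (A x' /\ A y')) => [[Ax' Ay']|nA'].
    + exact: fI.
    + by move=> E; case: (eA _ (gA _ _ Bx' By')); rewrite -E; apply: fA.
    + by move=> E; case: (eA _ (gA _ _ Bx By)); rewrite E; apply: fA.
    + move=> /(eI _ _ (gA _ _ Bx By) (gA _ _ Bx' By')).
      have [[dx xE] [dy yE]] := (dP _ Bx, dP _ By).
      have [[dx' xE'] [dy' yE']] := (dP _ Bx', dP _ By').
      move=> /(fI _ _ _ _ (fA _ _ (hA _) (hA _)) (fA _ _ dx dy)
        (fA _ _ (hA _) (hA _)) (fA _ _ dx' dy'))[].
      move=> /(fI _ _ _ _ (hA _) (hA _) (hA _) (hA _))[/hI tx /hI ty].
      move=> /(fI _ _ _ _ dx dy dx' dy')[dxx dyy].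
      have bI : injective nat_of_bool by case=> -[].
      by rewrite xE xE' yE yE' dxx dyy (bI _ _ tx) (bI _ _ ty).
have : B (e (h 0)) by right; exists (h 0).
by rewrite BA => /(eA _ (hA 0)).
Qed.

(** * Trees with [K] branches and closing off under operations *)

(** Formal terms: a leaf is the constant; a node holds the flag and label of an operation and its
    [K] arguments. *)
Inductive tree (K : Type) : Type :=
  | leaf : tree K
  | node : bool -> (K * K -> bool) -> (K -> tree K) -> tree K.
Arguments leaf {K}.
Arguments node {K} _ _ _.

Lemma card_tree_le {K : Type} : infinite_set [set: K] ->
  [set: tree K] #<= [set: K -> bool].
Proof.
move=> Kinf; have [p pI] := card_le_setT_inj (infinite_card_square Kinf).
move: (Kinf) => /infiniteP /card_le_setT_inj[h hI].
have [k0 _] := infinite_setN0 Kinf.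
pose i (q : bool * bool * (K * K)) :=
  p (p (h q.1.1, h q.1.2), p q.2).
have bI : injective nat_of_bool by case=> -[].
have iI : injective i.
  move=> [[a b] q] [[a' b'] q'] /pI /= [/pI[/hI/bI -> /hI/bI ->]].
  by move=> /pI ->.
have [d dK] := injective_left_inverse (true, true, (k0, k0)) i iI.
(* A node stores a marker, its flag, its label and the codes of its subtrees in
   disjoint regions of [K], so that structural recursion replaces any
   coding of paths. *)
pose fix e (t : tree K) : K -> bool := match t with
  | leaf => fun=> false
  | node b l f => fun k => match d k with
      | (true, true, _) => true
      | (true, false, _) => b
      | (false, true, q) => l q
      | (false, false, (k1, k2)) => e (f k1) k2 end end.
apply: (inj_setT_card_le (f := e)).
elim=> [|b l f IH] [|b' l' f'] //= E.
- by have /= := congr1 (fun u => u (i (true, true, (k0, k0)))) E; rewrite dK.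
- by have /= := congr1 (fun u => u (i (true, true, (k0, k0)))) E; rewrite dK.
have Ei q := congr1 (fun u => u (i q)) E.
congr node.
- by have /= := Ei (true, false, (k0, k0)); rewrite dK.
- by apply/funext => q; have /= := Ei (false, true, q); rewrite dK.
- apply/funext => k; apply: IH; apply/funext => k2.
  by have /= := Ei (false, false, (k, k2)); rewrite dK.
Qed.

(** The values of all terms form a closed set, no larger than the set of terms. *)
Lemma closing_off {K X : Type} (x0 : X)
    (op : bool -> (K * K -> bool) -> (K -> X) -> X) :
  infinite_set [set: K] ->
  exists H : set X, [/\ H x0, H #<= [set: K -> bool] &
    forall b l f, (forall k, H (f k)) -> H (op b l f)].
Proof.
move=> Kinf.
pose fix ev (t : tree K) : X := match t with
  | leaf => x0 | node b l f => op b l (fun k => ev (f k)) end.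
exists (range ev); split; first by exists leaf.
  exact: card_le_trans (card_image_le _ _) (card_tree_le Kinf).
move=> b l f /(_ _)/cid2-/all_sig2[t _ tf].
by exists (node b l t) => //=; congr op; apply/funext.
Qed.

(** * The cardinal invariants have their defining properties *)

Lemma infinite_sum_nat (A : Type) : infinite_set [set: (A + nat)%type].
Proof.
by apply/infiniteP; apply: (inj_setT_card_le (f := @inr A nat)) => ? ? [].
Qed.

(** One infinite witness rules out the default value [nat]; below, a sum with [nat] supplies it. *)
Lemma least_infinite_cardinalP (P : Type -> Prop) :
  (exists K, infinite_set [set: K] /\ P K) ->
  infinite_set [set: least_infinite_cardinal P] /\
  P (least_infinite_cardinal P).
Proof. by move=> /least_cardinalP[]. Qed.

Lemma aLP {X : topologicalType} (A : set X) : forall V : set (set X),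
  V `<=` open -> A `<=` \bigcup_(U in V) U ->
  exists W : set (set X),
    [/\ W `<=` V, W #<= [set: aL A] & A `<=` \bigcup_(U in W) closure U].
Proof.
have [|_ //] := @least_infinite_cardinalP (fun K => forall V : set (set X),
  V `<=` open -> A `<=` \bigcup_(U in V) U ->
  exists W : set (set X),
    [/\ W `<=` V, W #<= [set: K] & A `<=` \bigcup_(U in W) closure U]).
exists (set X + nat)%type; split; first exact: infinite_sum_nat.
move=> V _ AV; exists V; split=> //.
  by apply: (inj_in_card_le _ _ inl) => // ? ? _ _ [].
by apply: subset_trans AV _; apply: subset_bigcup => U _; apply: subset_closure.
Qed.

(** The disjoint sum of all [aL D] bounds the family, so the supremum is a genuine upper bound. *)
Lemma aL_le_aLb {X : topologicalType} (b : X -> EX X) (C : set X) :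
  c_closed b C -> [set: aL C] #<= [set: aLb b].
Proof.
move=> cC; apply: (@card_le_trans _ _ _ [set: sup_cardinal
  (fun K => exists2 C, c_closed b C & K = aL C)]); last first.
  by apply: (inj_setT_card_le (f := inl)) => ? ? [].
have [|h _] := @least_cardinalP (fun K => forall K' : Type,
  (exists2 C, c_closed b C & K' = aL C) -> [set: K'] #<= [set: K]).
  exists {D : set X & aL D} => _ [D _ ->].
  apply: (inj_setT_card_le (f := existT (fun D : set X => aL D) D)) => x y.
  exact: eq_from_Tagged.
by apply: h; exists C.
Qed.

Lemma t_cP {X : topologicalType} (b : X -> EX X) :
  infinite_set [set: t_c b] /\
  forall (A : set X) (x : X), c_ b A x ->
  exists B : set X, [/\ B `<=` A, B #<= [set: t_c b] & c_ b B x].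
Proof.
apply: least_infinite_cardinalP.
exists (X + nat)%type; split; first exact: infinite_sum_nat.
move=> A x Ax; exists A; split=> //.
by apply: (inj_in_card_le _ _ inl) => // ? ? _ _ [].
Qed.

(** In a Hausdorff space the closures of all open sets containing [x] meet only in [x]. *)
Lemma psi_cP {X : topologicalType} : hausdorff_space X ->
  infinite_set [set: psi_c X] /\
  forall x : X, exists V : set (set X),
    [/\ V #<= [set: psi_c X], forall U, V U -> open U /\ U x
      & [set x] = \bigcap_(U in V) closure U].
Proof.
rewrite open_hausdorff => hX; apply: least_infinite_cardinalP.
exists (set X + nat)%type; split; first exact: infinite_sum_nat.
move=> x; exists [set U | open U /\ U x]; split=> //.
  by apply: (inj_in_card_le _ _ inl) => // ? ? _ _ [].
apply/seteqP; split=> [_ -> U [_ Ux]|y yU]; first exact: subset_closure.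
apply: contrapT => /eqP; rewrite eq_sym => /hX[[U V] /=].
move=> [/set_mem Ux /set_mem Vy] [Uo Vo /eqP UV].
have [z] := yU U (conj Uo Ux) V (open_nbhs_nbhs (conj Vo Vy)).
by rewrite UV.
Qed.

(** * The operator [c_ b] *)

(** Two members of an open ultrafilter meet, so an open [U] with a point [z] of [hat b V] in
    [hat b U] meets [V]. *)
Lemma c_hat_closure {X : topologicalType} (b : X -> EX X) (V : set X) :
  open V -> c_ b (hat b V) `<=` closure V.
Proof.
move=> Vo y cy B; rewrite nbhsE => -[U [Uo Uy] UB].
have [z [Uz Vz]] := cy U Uo Uy.
have [[[_ _ n0 FI _] _] _] := proj2_sig (b z).
have [UV0|/set0P[t [Ut Vt]]] := eqVneq (U `&` V) set0.
  by case: n0; rewrite -UV0; apply: FI.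
by exists t; split=> //; apply: UB.
Qed.

Lemma c_mono {X : topologicalType} (b : X -> EX X) (A B : set X) :
  A `<=` B -> c_ b A `<=` c_ b B.
Proof.
by move=> AB x cx U Uo Ux; have [z [Uz /AB Bz]] := cx U Uo Ux; exists z.
Qed.

Lemma sub_c {X : topologicalType} (b : X -> EX X) (A : set X) :
  is_section b -> A `<=` c_ b A.
Proof. by move=> hb x Ax U Uo Ux; exists x; split=> //; apply: hb. Qed.

(** Shrink the test neighbourhood to lie inside [V]; an open ultrafilter containing the intersection
    contains both sets. *)
Lemma c_hatI {X : topologicalType} (b : X -> EX X) (A V : set X) (x : X) :
  open V -> V x -> c_ b A x -> c_ b (hat b V `&` A) x.
Proof.
move=> Vo Vx cx U Uo Ux.
have [z [UVz Az]] := cx (U `&` V) (openI Uo Vo) (conj Ux Vx).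
have [[[_ _ _ _ Fup] _] _] := proj2_sig (b z).
by exists z; split; [|split] => //; [apply: Fup UVz|apply: Fup UVz];
  rewrite // => t [].
Qed.

(* The traces of [A] on the sets [hat b (v k)] determine a point of [c_ b A];
   this bounds the number of such points. *)
Lemma c_point_traces {X : topologicalType} {K : Type} (b : X -> EX X)
    (v : K -> set X) (A : set X) (x : X) :
  (forall k, open (v k) /\ v k x) ->
  [set x] = \bigcap_k closure (v k) -> c_ b A x ->
  [set x] = \bigcap_k c_ b (hat b (v k) `&` A).
Proof.
move=> vP xv cx; apply/seteqP; split=> [_ -> k _|y cy].
  by have [vo vx] := vP k; apply: c_hatI.
rewrite xv => k _; apply: (c_hat_closure b); first by have [] := vP k.
by apply: c_mono (cy k I) => z [].
Qed.

(** * The cardinality bound *)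

Theorem theorem4p4 (X : topologicalType) (hX : hausdorff_space X)
    (b' : X -> EX X) (hb' : is_section b')
    (hmin : [set: aLb b'] #= [set: aL' X]) :
  [set: X] #<= [set: ((aL' X * t_c b' * psi_c X)%type -> bool)].
Proof.
have [[x0 _]|X0] := pselect ([set: X] !=set0); last first.
  by have -> : [set: X] = set0; [apply: contrapT => /eqP/set0P|apply: card_ge0].
pose K := (aL' X * t_c b' * psi_c X)%type.
have [psi_inf psiP] := psi_cP hX.
have [p0 _] := infinite_setN0 psi_inf.
have [/infinite_setN0[t0 _] tcP] := t_cP b'.
have aLb_aL' : [set: aLb b'] #<= [set: aL' X].
  by move: hmin; rewrite card_eq_le => /andP[].
have [a0 _] : [set: aL' X] !=set0.
  by have [i _] := card_le_setT_inj aLb_aL'; exists (i (inr 0)).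
have aLbK : [set: aLb b'] #<= [set: K].
  apply: card_le_trans aLb_aL' _.
  by apply: (inj_setT_card_le (f := fun a => (a, t0, p0))) => ? ? [].
have tcK : [set: t_c b'] #<= [set: K].
  by apply: (inj_setT_card_le (f := fun t => (a0, t, p0))) => ? ? [].
have psiK : [set: psi_c X] #<= [set: K].
  by apply: (inj_setT_card_le (f := fun p => (a0, t0, p))) => ? ? [].
have Kinf : infinite_set [set: K].
  by apply/infiniteP; apply: card_le_trans psiK; apply/infiniteP.
have /(_ _)/cid-/all_sig[v vP] x : exists v : K -> set X,
    (forall k, open (v k) /\ v k x) /\ [set x] = \bigcap_k closure (v k).
  have [V [VK VP xV]] := psiP x.
  have [[U VU]|V0] := pselect (exists U, V U).
    have [v vV] := card_le_setT_enum V U VU (card_le_trans VK psiK).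
    exists v; split=> [k|]; first by apply: VP; rewrite -vV; exists k.
    by rewrite xV -vV bigcap_image.
  (* An empty family has the whole space as intersection, so [x] is the only point. *)
  exists (fun=> setT); split=> [k|]; first by split=> //; apply: openT.
  rewrite xV; apply/seteqP; split=> y _ U; first by rewrite closureT.
  by move=> VU; case: V0; exists U.
(* With [true], row [k] of the label selects the [k]-th trace; with [false], a pair [(j, k)] selects
   the [k]-th neighbourhood of [f j]. The default is [x0]. *)
pose op (b : bool) (l : K * K -> bool) (f : K -> X) : X :=
  if b then xget x0 [set x | [set x] =
    \bigcap_k c_ b' (f @` [set j | l (k, j)])]
  else xget x0 (~` \bigcup_(p in [set p | l p]) closure (v (f p.1) p.2)).
have [H [Hx0 HK Hop]] := closing_off x0 op Kinf.
suff HT : H = setT by rewrite -HT.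
have Hc : c_closed b' H.
  apply/seteqP; split; last exact: sub_c.
  move=> x /tcP[B [BH BK Bx]].
  have [y [_ By]] := Bx setT openT I.
  have [f fB] := card_le_setT_enum B y By (card_le_trans BK tcK).
  pose l (p : K * K) := `[< hat b' (v x p.1) (f p.2) >].
  have lB k : f @` [set j | l (k, j)] = hat b' (v x k) `&` B.
    apply/seteqP; split=> [_ [j /asboolP lj <-]|z [lz]].
      by split=> //; rewrite -fB; exists j.
    by rewrite -fB => -[j _ fj]; exists j => //; apply/asboolP; rewrite /= fj.
  have <- : op true l f = x.
    have [vo vx] := vP x; have xE := c_point_traces b' (v x) B x vo vx Bx.
    apply: xget_unique => [|z] /=; under eq_bigcapr do rewrite lB.
      exact: xE.
    by rewrite -xE => zx; have : [set x] z by rewrite -zx.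
  by apply: Hop => k; apply: BH; rewrite -fB; exists k.
apply/seteqP; split=> // q _; apply: contrapT => nHq.
(* A point [x] of [H] differs from [q], so the closure of some [v x k] misses [q]. *)
have /(_ _)/cid-/all_sig[k kP] x : exists k, H x -> ~ closure (v x k) q.
  have [Hx|nHx] := pselect (H x); last by exists (a0, t0, p0).
  apply: contrapT => /forallNP nk; apply: nHq; suff -> : q = x by [].
  suff : [set x] q by [].
  rewrite (vP x).2 => j _; apply: contrapT => nj.
  by apply: (nk j).
pose V := [set v x (k x) | x in H].
have [||W [WV WK HW]] := aLP H V.
- by move=> _ [x _ <-]; have [/(_ (k x))[]] := vP x.
- move=> x Hx; exists (v x (k x)); first by exists x.
  by have [/(_ (k x))[]] := vP x.
have [U0 WU0 _] := HW _ Hx0.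
have WleK := card_le_trans WK (card_le_trans (aL_le_aLb b' H Hc) aLbK).
have [w wW] := card_le_setT_enum W U0 WU0 WleK.
have /(_ _)/cid2-/all_sig2[f fH fw] j : exists2 x, H x & v x (k x) = w j.
  by apply: WV; rewrite -wW; exists j.
(* For each [j], only the chosen neighbourhood of [f j] is selected. *)
pose l (p : K * K) := `[< k (f p.1) = p.2 >].
(* Since [q] avoids all selected closures, the operation does not fall back on [x0]. *)
have [] : (~` \bigcup_(p in [set p | l p]) closure (v (f p.1) p.2))
    (op false l f).
  apply: xgetPex; exists q => -[[j _] /asboolP /= <-].
  exact: kP.
(* The value lies in [H], hence in one of the selected closures. *)
have [U + clU] := HW _ (Hop false l f fH).
rewrite -wW => -[j _ wU]; exists (j, k (f j)); first exact/asboolP.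
by rewrite /= fw wU.
Qed.
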